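(* Let $n\ge 1$ be an integer and let $X\subset\mathbb{R}^{2n}$ be a closed bounded subset. Suppose that $X$ contains Sternfeld arrays of arbitrarily large size, i.e. for every integer $N$ there are an integer $m\ge N$ and a Sternfeld array $(a_i)_{i\in[m]^n}$ of size $m$ in $\mathbb{R}^{2n}$ such that $a_i\in X$ for all $i\in[m]^n$. Then $X$ is not basic.
   Context: Notation: $[m]=\{1,\ldots,m\}$. For a point $y$ of a power $Y^d$ of a set $Y$, $y_k$ denotes its $k$-th coordinate. For an array $(a_i)_{i\in[m]^n}$ of points of $\mathbb{R}^{2n}$, $a_{i,k}$ denotes the $k$-th coordinate of the point $a_i$, $k\in[2n]$. Basic set: a subset $X\subset\mathbb{R}^d$ is basic if for any continuous function $f\colon X\to\mathbb{R}$ there are continuous functions $\varphi_1,\ldots,\varphi_d\colon\mathbb{R}\to\mathbb{R}$ such that $f(x_1,\ldots,x_d)=\varphi_1(x_1)+\ldots+\varphi_d(x_d)$ for any $(x_1,\ldots,x_d)\in X$. (Here it is used with $d=2n$.) Adjacency: elements (voxels) $i,j\in[m]^n$ are adjacent by the coordinate $t\in[n]$ if $j=(i_1,\ldots,i_{t-1},i_t\pm1,i_{t+1},\ldots,i_n)$. For a pair $\{i,j\}$ of voxels adjacent by the coordinate $t$, named so that $j_t=i_t+1$, put $\xi(t)=\xi(i,j,t):=2t-\rho_2(i_t)$, where $\rho_2(x)=x\bmod 2\in\{0,1\}$. Thus $\xi(t)=2t-1$ if the smaller $t$-th index $i_t$ is odd and $\xi(t)=2t$ if it is even. Sternfeld array: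 an $n$-dimensional array $(a_i)_{i\in[m]^n}$ consisting of pairwise distinct points of $\mathbb{R}^{2n}$ is a Sternfeld array of size $m$ in $\mathbb{R}^{2n}$ if for each $t\in[n]$ and each pair $\{i,j\}$ of voxels adjacent by the coordinate $t$ we have $a_{i,\xi(t)}=a_{j,\xi(t)}$. *)

(* Defs.v *)
From HB Require Import structures.
From mathcomp Require Import all_boot all_order all_algebra.
From mathcomp Require Import all_classical all_reals all_analysis.

Set Implicit Arguments.
Unset Strict Implicit.
Unset Printing Implicit Defensive.

Import Order.TTheory GRing.Theory Num.Theory.
Import numFieldNormedType.Exports.

Local Open Scope classical_set_scope.
Local Open Scope ring_scope.

(* A continuous f : X -> R is represented by a function on the whole space
   which is continuous for the subspace topology of X; its values outside X
   play no role. *)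
Definition basic (R : realType) (d : nat) (X : set 'rV[R]_d) : Prop :=
  forall f : 'rV[R]_d -> R, {within X, continuous f} ->
    exists phi : 'I_d -> R -> R,
      (forall k, continuous (phi k)) /\
      (forall x, X x -> f x = \sum_(k < d) phi k (x 0 k)).

(* Voxel coordinates, directions and coordinates of points are 0-based: the
   1-based index of an ordinal i is i.+1. *)
Definition voxel (n m : nat) := {ffun 'I_n -> 'I_m}.

Definition adjacent (n m : nat) (t : 'I_n) (i j : voxel n m) : Prop :=
  ((j t = (i t).+1 :> nat) \/ (i t = (j t).+1 :> nat)) /\
  (forall s, s != t -> j s = i s).

(* The formula 2 t - (x mod 2), for 1-based t and x. *)
Definition xi (t x : nat) : nat := (2 * t - x %% 2)%N.

Lemma xi_pred_subproof (n m : nat) (t : 'I_n) (x : 'I_m) :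
  ((xi t.+1 x.+1).-1 < 2 * n)%N.
Proof.
rewrite /xi mulnS add2n; apply: (@leq_ltn_trans (2 * t).+1).
  by rewrite -ltnS (leq_trans _ (leqnn _)) // ltnS -subn1 leq_subLR add1n leq_subr.
by rewrite -[(2 * t).+2]add2n -mulnS leq_mul2l /=.
Qed.

Definition xi_ord (n m : nat) (t : 'I_n) (x : 'I_m) : 'I_(2 * n) :=
  Ordinal (xi_pred_subproof t x).

Definition Sternfeld_array (R : realType) (n m : nat)
    (a : voxel n m -> 'rV[R]_(2 * n)) : Prop :=
  injective a /\
  (forall (t : 'I_n) (i j : voxel n m),
     adjacent t i j -> j t = (i t).+1 :> nat ->
     a i 0 (xi_ord t (i t)) = a j 0 (xi_ord t (i t))).

(* Main.v *)
Require Import Defs.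
From mathcomp Require Import all_boot all_order all_algebra.
From mathcomp Require Import all_classical all_reals all_analysis.
From mathcomp Require Import lra ring zify.

Set Implicit Arguments.
Unset Strict Implicit.
Unset Printing Implicit Defensive.

Import Order.TTheory GRing.Theory Num.Theory.
Import numFieldNormedType.Exports.

Local Open Scope classical_set_scope.
Local Open Scope ring_scope.

(** A Sternfeld array [a] of size [m] carries the measure giving the point
[a i] the mass [m^-n] with the sign [(-1)^(i_1 + ... + i_n)].  Its total
variation is 1, since the points are distinct; but the total variation of its
projection to any coordinate axis is at most [2 / m].  Indeed, the axis
number [2t - 1] or [2t] glues the layers of the array in direction [t] in
consecutive pairs, the two points of a pair have opposite signs and cancel in
the projection, and only voxels of the first and the last layer can stay
unpaired ([Sternfeld_mean_coord]).

So on a sum [f] of functions of one coordinate that are bounded on [X], the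
integral against this measure is [O(1 / m)], with a constant that depends on
[f].  On the other hand, a continuous function of norm 1 can take the value
[(-1)^(i_1 + ... + i_n)] at each [a i] ([sign_interpolation]), and its integral
is 1.  If [X] were basic, the measures multiplied by [m] would thus be
pointwise bounded on the continuous functions, although their norms are not
bounded: this contradicts the uniform boundedness principle.  The principle is
used in the form [gliding_hump]: along arrays of size at least [(j + 1) 3^j]
one continuous function has integrals of absolute value at least [3^-j / 2],
whereas a sum of functions of one coordinate has integrals
[O(3^-j / (j + 1))]. *)

(** * Condensation of singularities *)

Lemma continuous_uniform_approx (R : realType) (T : topologicalType)
    (F : T -> R) :
  (forall e, 0 < e -> exists2 g : T -> R, continuous g &
     forall x, `|F x - g x| <= e) ->
  continuous F.
Proof.
move=> approx x; apply/cvgrPdist_le => e e0.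
have e3 : 0 < e / 3 by lra.
have [g cg gF] := approx _ e3.
have /cvgrPdist_le /(_ _ e3) := cg x.
apply: filterS => y gxy.
have := gF x; have := gF y; move: gxy; rewrite !ler_norml.
by move=> /andP[? ?] /andP[? ?] /andP[? ?]; apply/andP; split; lra.
Qed.

(** The intervals [[u j - r j, u j + r j]] are nested, so they have a common
point; the supremum of their left ends is one. *)
Lemma telescoping_limit (R : realType) (u r : nat -> R) :
  (forall j, 0 <= r j) -> (forall j, `|u j.+1 - u j| <= r j - r j.+1) ->
  exists l, forall j, `|l - u j| <= r j.
Proof.
move=> r0 step.
have lo_nd : {homo (fun j => u j - r j) : i j / (i <= j)%N >-> i <= j}.
  apply/nondecreasing_seqP => j.
  by have := step j; rewrite ler_norml => /andP[? ?]; lra.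
have hi_ni : {homo (fun j => - (u j + r j)) : i j / (i <= j)%N >-> i <= j}.
  apply/nondecreasing_seqP => j.
  by have := step j; rewrite ler_norml => /andP[? ?]; lra.
have lo_hi i j : u i - r i <= u j + r j.
  have := lo_nd _ _ (leq_maxl i j); have := hi_ni _ _ (leq_maxr i j).
  by have := r0 (maxn i j) => /=; lra.
set E := range (fun j => u j - r j).
have ubE j : ubound E (u j + r j) by move=> _ [i _ <-].
exists (sup E) => j; rewrite ler_distl; apply/andP; split.
  by apply: ub_le_sup; [exists (u 0%N + r 0%N); exact: ubE | exists j].
by apply: ge_sup => //; exists (u 0%N - r 0%N); exists 0%N.
Qed.

(** For a quantitative uniform boundedness principle without Baire category,
take [u (j + 1) = u j + c * h j] with [c = 3^-j] or [c = - 3^-j], the sign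
being chosen so that [L j (u j)] and [L j (c * h j)] do not cancel: then
[L j (u (j + 1))] has absolute value at least [3^-j].  All later steps together
change the function by at most [3^-(j+1) + 3^-(j+2) + ... = 3^-j / 2], so they
destroy at most half of this value. *)
Lemma gliding_hump (R : realType) (T : topologicalType)
    (L : nat -> (T -> R) -> R) (h : nat -> T -> R) :
  (forall j f g c, L j (fun x => f x + c * g x) = L j f + c * L j g) ->
  (forall j f c, (forall x, `|f x| <= c) -> `|L j f| <= c) ->
  (forall j, continuous (h j)) ->
  (forall j x, `|h j x| <= 1) ->
  (forall j, L j (h j) = 1) ->
  exists2 F : T -> R, continuous F & forall j, 3^-1 ^+ j / 2 <= `|L j F|.
Proof.
move=> Llin Lbnd hcont hbnd Lh.
pose step j (f : T -> R) : T -> R :=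
  fun x => f x + (if 0 <= L j f then 3^-1 ^+ j else - 3^-1 ^+ j) * h j x.
pose u := fix u j : T -> R := if j is k.+1 then step k (u k) else fun=> 0.
have p0 j : 0 < 3^-1 ^+ j :> R by apply: exprn_gt0; lra.
have Lu j : 3^-1 ^+ j <= `|L j (u j.+1)|.
  rewrite /= /step Llin Lh mulr1; have := p0 j.
  by case: (leP 0 (L j (u j))) => ? ?;
    [rewrite ger0_norm | rewrite ltr0_norm]; lra.
have ucont j : continuous (u j).
  elim: j => [|j IH] x; first exact: cvg_cst.
  by apply: cvgD; [exact: IH | apply: cvgMr; exact: hcont].
have udist x j :
    `|u j.+1 x - u j x| <= 3 / 2 * 3^-1 ^+ j - 3 / 2 * 3^-1 ^+ j.+1.
  have -> : 3 / 2 * 3^-1 ^+ j - 3 / 2 * 3^-1 ^+ j.+1 = 3^-1 ^+ j :> R.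
    by rewrite exprS; field.
  rewrite /= /step addrC addKr normrM -[leRHS]mulr1.
  apply: ler_pM => //; case: ifP => _; rewrite ?normrN ger0_norm // ltW //.
(* The radius [3 / 2 * 3^-j] is the sum of the steps [3^-k] with [k >= j]. *)
have /choice[F FP] (x : T) :
    exists l, forall j, `|l - u j x| <= 3 / 2 * 3^-1 ^+ j.
  apply: (telescoping_limit (u := fun j => u j x)) => j; last exact: udist.
  by apply: mulr_ge0; [lra | exact/ltW].
exists F.
  apply: continuous_uniform_approx => e e0.
  have /cvgrPdist_lt /(_ e e0) [N _ /(_ N (leqnn N))] :
      (fun j => 3 / 2 * 3^-1 ^+ j : R) @ \oo --> (0 : R).
    rewrite -[X in _ --> X](mulr0 (3 / 2)); apply: cvgMr.
    by apply: cvg_expr; rewrite ger0_norm; lra.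
  rewrite sub0r normrN => eN; exists (u N) => // x.
  by apply: le_trans (FP x N) _; apply: le_trans (ler_norm _) _; exact: ltW.
move=> j.
have : `|L j (fun x => F x + (-1) * u j.+1 x)| <= 3^-1 ^+ j / 2.
  apply: Lbnd => x; rewrite mulN1r; apply: le_trans (FP x j.+1) _.
  by rewrite exprS; lra.
rewrite Llin mulN1r => close; have := Lu j.
have := lerB_dist (L j (u j.+1)) (L j F); rewrite distrC.
by move: (3^-1 ^+ j) close => p; lra.
Qed.

(** * Signed means *)

(** The integral of [f] against a signed measure with atoms [a i] of equal
absolute mass; the bit [s i] is true when the mass at [a i] is negative. *)
Definition signed_mean (R : realType) (I : finType) (T : Type)
    (s : I -> bool) (a : I -> T) (f : T -> R) : R :=
  #|I|%:R^-1 * \sum_i (-1) ^+ s i * f (a i).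

Section SignedMean.
Context {R : realType} {I : finType} {T : Type} (s : I -> bool) (a : I -> T).
Local Notation mean := (@signed_mean R I T s a).

Lemma signed_meanD (f g : T -> R) (c : R) :
  mean (fun x => f x + c * g x) = mean f + c * mean g.
Proof.
rewrite /signed_mean (mulrCA c) -mulrDr [c * _]mulr_sumr -big_split /=.
by congr (_ * _); apply: eq_bigr => i _; ring.
Qed.

Lemma signed_mean_sum (J : finType) (f : J -> T -> R) :
  mean (fun x => \sum_k f k x) = \sum_k mean (f k).
Proof.
rewrite /signed_mean -mulr_sumr exchange_big /=; congr (_ * _).
by apply: eq_bigr => i _; rewrite mulr_sumr.
Qed.

Lemma eq_signed_mean (f g : T -> R) :
  (forall i, f (a i) = g (a i)) -> mean f = mean g.
Proof. by move=> fg; congr (_ * _); apply: eq_bigr => i _; rewrite fg. Qed.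

Hypothesis I0 : (0 < #|I|)%N.

Lemma signed_mean_bound (f : T -> R) (c : R) :
  (forall x, `|f x| <= c) -> `|mean f| <= c.
Proof.
move=> fc; rewrite normrM normfV normr_nat mulrC ler_pdivrMr ?ltr0n //.
apply: le_trans (ler_norm_sum _ _ _) _.
rewrite mulr_natr -sumr_const; apply: ler_sum => i _.
by rewrite normrM normrX normrN1 expr1n mul1r.
Qed.

Lemma signed_mean_sign (f : T -> R) :
  (forall i, f (a i) = (-1) ^+ s i) -> mean f = 1.
Proof.
move=> fs; rewrite /signed_mean (eq_bigr (fun=> 1)).
  by rewrite sumr_const mulVf // pnatr_eq0 -lt0n.
by move=> i _; rewrite fs -signr_addb addbb.
Qed.

End SignedMean.

(** The points of each sign form a finite, hence closed set, and these two sets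
are disjoint: the Urysohn lemma separates them by the values -1 and 1. *)
Lemma sign_interpolation (R : realType) (T : pseudoMetricType R) (I : finType)
    (s : I -> bool) (a : I -> T) :
  hausdorff_space T -> injective a ->
  exists h : T -> R, [/\ continuous h, forall x, `|h x| <= 1 &
    forall i, h (a i) = (-1) ^+ s i].
Proof.
move=> hT inj_a.
pose A b := a @` [set i | s i = b].
have closedA b : closed (A b).
  apply: (accessible_finite_set_closed.1 (hausdorff_accessible hT)).
  exact/finite_image.
have disj : A true `&` A false = set0.
  apply/seteqP; split => // x [[i /= si <-] [j /= sj /inj_a ji]].
  by rewrite ji si in sj.
have [|h [ch hT1 hF1 hrange]] :=
  @urysohn_ext_itv T R pseudometric_normal _ _ (-1) 1
    (closedA true) (closedA false) disj.
  lra.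
exists h; split=> // [x|i].
  rewrite ler_norml; have /= := hrange (h x); rewrite in_itv /=; apply.
  by exists x.
case si: (s i); first by apply: hT1; exists (a i) => //; exists i.
by apply: hF1; exists (a i) => //; exists i.
Qed.

(** * Cancellation along one coordinate *)

(** The terms that [h] moves cancel in pairs. *)
Lemma sum_involution (R : realType) (I : finType) (h : I -> I) (g : I -> R) :
  involutive h -> (forall i, h i != i -> g (h i) = - g i) ->
  \sum_i g i = \sum_(i | h i == i) g i.
Proof.
move=> hK hg; rewrite (bigID (fun i => h i == i)) /=.
suff : \sum_(i | h i != i) g i = - \sum_(i | h i != i) g i by lra.
rewrite -sumrN [LHS](reindex_inj (inv_inj hK)) /=.
apply: eq_big => [i|i]; first by rewrite hK eq_sym.
by rewrite hK eq_sym => /hg.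
Qed.

(** The involution of {0, ..., m-1} that swaps [x] and [x + 1] whenever [x] has
the parity [p].  An index without partner is fixed: [insubd] returns [x] when
the target leaves the range above, and truncated [0.-1] is [0] below. *)
Definition partner (m : nat) (p : bool) (x : 'I_m) : 'I_m :=
  insubd x (if odd x == p then x.+1 else x.-1).

Variant partner_spec (m : nat) (p : bool) (x y : 'I_m) : Prop :=
| PartnerSucc of odd x = p & y = x.+1 :> nat
| PartnerPred of odd y = p & x = y.+1 :> nat
| PartnerFirst of y = x & odd x = ~~ p & x = 0%N :> nat
| PartnerLast of y = x & odd x = p & x.+1 = m.

Lemma partnerP (m : nat) (p : bool) (x : 'I_m) :
  partner_spec p x (partner p x).
Proof.
case: (eqVneq (odd x) p) => [xp|xp].
  case: (ltnP x.+1 m) => xm.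
    by apply: PartnerSucc => //; rewrite /partner xp eqxx val_insubd xm.
  apply: PartnerLast => //; last by apply/eqP; rewrite eqn_leq xm ltn_ord.
  by apply: val_inj; rewrite /partner xp eqxx val_insubd ltnNge xm.
have vy : partner p x = x.-1 :> nat.
  by rewrite /partner (negPf xp) val_insubd (leq_ltn_trans (leq_pred x)).
have {}xp : odd x = ~~ p by move: xp; case: odd; case: (p).
case: (posnP x) => x0.
  by apply: PartnerFirst => //; apply: val_inj; rewrite /= vy x0.
apply: PartnerPred; rewrite vy ?prednK //.
by move: xp; rewrite -{1}(prednK x0) /=; case: odd; case: (p).
Qed.

Lemma partnerK (m : nat) (p : bool) : involutive (@partner m p).
Proof.
move=> x; apply: val_inj => /=; have := ltn_ord x.
case: (partnerP p x) => [xp e|yp e|e _ _|e _ _]; rewrite ?e //;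
  case: (partnerP p (partner p x)) => [+ e'|+ e'|-> + e'|-> + e']; lia.
Qed.

(** The neighbour in direction [t] that shares with [i] the coordinate number
[2 * t + p], directions and coordinates being counted from 0. *)
Definition flip (n m : nat) (t : 'I_n) (p : bool) (i : voxel n m) : voxel n m :=
  [ffun s => if s == t then partner p (i s) else i s].

Lemma flipK (n m : nat) (t : 'I_n) (p : bool) : involutive (@flip n m t p).
Proof.
move=> i; apply/ffunP => s; rewrite !ffunE.
by case: eqP => // ->; rewrite partnerK.
Qed.

Lemma flip_neq (n m : nat) (t : 'I_n) (p : bool) (i : voxel n m) :
  flip t p i != i -> partner p (i t) != i t.
Proof.
apply: contraNneq => e; apply/eqP/ffunP => s; rewrite ffunE.
by case: eqP => // ->.
Qed.

Definition odd_voxel (n m : nat) (i : voxel n m) : bool := odd (\sum_s i s).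

Lemma odd_flip (n m : nat) (t : 'I_n) (p : bool) (i : voxel n m) :
  flip t p i != i -> odd_voxel (flip t p i) = ~~ odd_voxel i.
Proof.
move=> /flip_neq ne; rewrite /odd_voxel (bigD1 t) //= [in RHS](bigD1 t) //=.
rewrite (eq_bigr (fun s => val (i s))); last first.
  by move=> s st; rewrite ffunE (negPf st).
rewrite ffunE eqxx !oddD -addNb; congr (_ (+) _).
case: (partnerP p (i t)) ne => [_ ->|_ ->|->|->]; rewrite ?eqxx //=.
by rewrite negbK.
Qed.

(** Stated without division or [n.-1]: replacing the coordinate [t] of the
voxels of a slice in all possible ways yields [m] times as many distinct
voxels. *)
Lemma card_slice (n m : nat) (t : 'I_n) (c : 'I_m) :
  (m * #|[set i : voxel n m | i t == c]%SET| <= m ^ n)%N.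
Proof.
pose put (w : 'I_m * voxel n m) : voxel n m :=
  [ffun s => if s == t then w.1 else w.2 s].
set S := [set i | _]%SET.
have -> : (m * #|S| = #|finset.setX [set: 'I_m]%SET S|)%N.
  by rewrite cardsX cardsT card_ord.
have -> : (m ^ n = #|voxel n m|)%N by rewrite card_ffun !card_ord.
rewrite -(card_in_imset (f := put)) ?max_card //.
move=> [x i] [y j]; rewrite !inE /= => /eqP it /eqP jt /ffunP e.
have -> : x = y by have := e t; rewrite !ffunE eqxx.
congr (_, _); apply/ffunP => s; have := e s; rewrite !ffunE.
by case: eqP => // -> _; rewrite it jt.
Qed.

(** A voxel fixed by [flip t p] lies in the first or in the last slice. *)
Lemma card_fixed_flip (n m : nat) (t : 'I_n) (p : bool) :
  (m * #|[set i : voxel n m | flip t p i == i]%SET| <= 2 * m ^ n)%N.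
Proof.
case: m => [|m] //.
pose S c := [set i : voxel n m.+1 | i t == c]%SET.
apply: (@leq_trans (m.+1 * #|(S ord0 :|: S ord_max)%SET|)); last first.
  rewrite mul2n -addnn.
  apply: leq_trans (leq_add (card_slice t ord0) (card_slice t ord_max)).
  by rewrite -mulnDr leq_mul2l /= cardsU leq_subr.
rewrite leq_mul2l /=; apply/subset_leq_card/fintype.subsetP => i.
rewrite !inE => /eqP /ffunP /(_ t).
rewrite ffunE eqxx => /(congr1 val) /=; rewrite -!val_eqE /=.
by case: (partnerP p (i t)) => [_ -> /esym /n_Sn|_ -> /n_Sn|_ _ ->|_ _ [->]] //;
  rewrite eqxx orbT.
Qed.

(** Every coordinate [k] occurs in the definition of a Sternfeld array, for the
direction [k./2] and the steps that start at an index of the parity of [k]. *)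
Lemma xi_ord_half (n m : nat) (k : 'I_(2 * n)) (t : 'I_n) (x : 'I_m) :
  t = k./2 :> nat -> odd x = odd k -> xi_ord t x = k.
Proof. by move=> tk xk; apply: val_inj; rewrite /= /xi; lia. Qed.

(** Voxels exchanged by the flip in direction [k./2] have equal coordinates [k]
and opposite signs.  So only the fixed voxels contribute, and these are at most
a fraction [2 / m] of all voxels. *)
Lemma Sternfeld_mean_coord (R : realType) (n m : nat)
    (a : voxel n m -> 'rV[R]_(2 * n)) (k : 'I_(2 * n)) (g : R -> R) (C : R) :
  Sternfeld_array a -> (0 < m)%N -> (forall i, `|g (a i 0 k)| <= C) ->
  `|signed_mean (@odd_voxel n m) a (fun x => g (x 0 k))| <= 2 * C / m%:R.
Proof.
move=> [_ Sa] m0 gC.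
have t_lt : (k./2 < n)%N by have := ltn_ord k; lia.
pose t := Ordinal t_lt; pose p := odd k.
have adj (i j : voxel n m) : odd (i t) = p -> j t = (i t).+1 :> nat ->
    (forall s, s != t -> j s = i s) -> a i 0 k = a j 0 k.
  move=> it jt ij; have := Sa t i j; rewrite (xi_ord_half (k := k)) //.
  by apply=> //; split=> //; left.
have same i : flip t p i != i -> a (flip t p i) 0 k = a i 0 k.
  move=> /flip_neq.
  have := partnerP p (i t).
  have <- : flip t p i t = partner p (i t) by rewrite ffunE eqxx.
  have off s : s != t -> flip t p i s = i s.
    by move=> st; rewrite ffunE (negPf st).
  case=> [it e|it e|->|->]; rewrite ?eqxx // => _.
    by rewrite (adj _ _ it e off).
  by apply: adj => // s st; rewrite off.
rewrite /signed_mean (sum_involution (h := flip t p)); first last.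
- by move=> i ne; rewrite same // odd_flip // signrN mulNr.
- exact: flipK.
rewrite card_ffun !card_ord normrM normfV normr_nat.
rewrite ler_pdivlMr ?ltr0n // -mulrA.
rewrite ler_pdivrMl ?ltr0n ?expn_gt0 ?m0 // [leLHS]mulrC.
have C0 : 0 <= C.
  by apply: le_trans (gC [ffun=> Ordinal m0]).
pose fixed := [set i : voxel n m | flip t p i == i]%SET.
apply: (@le_trans _ _ ((m * #|fixed|)%:R * C)); last first.
  rewrite mulrA; apply: ler_wpM2r => //; rewrite mulrC -natrM ler_nat.
  exact: card_fixed_flip.
rewrite natrM -mulrA; apply: ler_wpM2l => //.
apply: le_trans (ler_norm_sum _ _ _) _.
rewrite cardsE mulr_natl -sumr_const; apply: ler_sum => i _.
by rewrite normrM normrX normrN1 expr1n mul1r.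
Qed.

(** * Sets with large Sternfeld arrays are not basic *)

(** Coordinates of points of [X] stay in a segment, where each [phi k] is
bounded. *)
Lemma bounded_coords (R : realType) (d : nat) (X : set 'rV[R]_d)
    (phi : 'I_d -> R -> R) :
  bounded_set X -> (forall k, continuous (phi k)) ->
  exists C, forall x k, X x -> `|phi k (x 0 k)| <= C.
Proof.
move=> [M [_ XM]] cphi.
pose r := `|M| + 1.
have Xr x k : X x -> x 0 k \in `[- r, r].
  move=> Xx; rewrite in_itv /= -ler_norml.
  apply: le_trans (XM r _ x Xx); last by rewrite /r; have := ler_norm M; lra.
  rewrite [leRHS]/Num.norm /= mx_normrE; apply/bigmax_geP; right.
  by exists (0, k).
have /choice[c cP] (k : 'I_d) :
    exists c, forall y, y \in `[- r, r] -> `|phi k y| <= c.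
  have rr : - r <= r by rewrite /r; have := normr_ge0 M; lra.
  have [|y _ H] := @EVT_max R (fun y => `|phi k y|) _ _ rr.
    apply: continuous_subspaceT => z; apply: (cvg_comp _ _ (cphi k z)).
    exact: norm_continuous.
  by exists `|phi k y|.
exists (\sum_k `|c k|) => x k Xx.
apply: le_trans (cP k _ (Xr x k Xx)) _; apply: le_trans (ler_norm _) _.
by rewrite (bigD1 k) //= lerDl sumr_ge0.
Qed.

Unset Implicit Arguments.
Set Strict Implicit.

Theorem mainTheorem1 (R : realType) (n : nat) (hn : (1 <= n)%N)
    (X : set 'rV[R]_(2 * n))
    (hclosed : closed X) (hbounded : bounded_set X)
    (hSternfeld : forall N : nat, exists m : nat, (N <= m)%N /\
       exists a : voxel n m -> 'rV[R]_(2 * n),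
         Sternfeld_array a /\ (forall i, X (a i))) :
  ~ basic X.
Proof.
move=> Xbasic.
pose arr := {m : nat & voxel n m -> 'rV[R]_(2 * n)}.
(* The factor [3 ^ j] beats the lower bound of [gliding_hump]; the factor [j.+1]
   is left over and must exceed any constant. *)
have /choice[A AP] (j : nat) : exists b : arr,
    [/\ (j.+1 * 3 ^ j <= projT1 b)%N, Sternfeld_array (projT2 b) &
        forall i, X (projT2 b i)].
  have [m [mj [a [Sa Xa]]]] := hSternfeld (j.+1 * 3 ^ j)%N.
  by exists (existT _ m a).
pose m j := projT1 (A j); pose a j : voxel n (m j) -> _ := projT2 (A j).
have m0 j : (0 < m j)%N.
  by have [mj _ _] := AP j; apply: leq_trans mj; rewrite muln_gt0 expn_gt0.
have I0 j : (0 < #|voxel n (m j)|)%N by rewrite card_ffun !card_ord expn_gt0 m0.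
pose L j := signed_mean (R := R) (@odd_voxel n (m j)) (a j).
have /choice[h hP] (j : nat) : exists h : 'rV[R]_(2 * n) -> R,
    [/\ continuous h, forall x, `|h x| <= 1 &
      forall i, h (a j i) = (-1) ^+ odd_voxel i].
  apply: sign_interpolation; first exact: norm_hausdorff.
  by have [_ [inj_a _] _] := AP j.
have [|||||F cF LF] := @gliding_hump R _ L h.
- by move=> j f g c; exact: signed_meanD.
- by move=> j f c; exact: signed_mean_bound.
- by move=> j; have [] := hP j.
- by move=> j; have [] := hP j.
- by move=> j; have [_ _ ?] := hP j; exact: signed_mean_sign.
have [phi [cphi phiF]] := Xbasic F (continuous_subspaceT cF).
have [C CP] := bounded_coords hbounded cphi.
pose B := 8 * n%:R * C.
have key j : j.+1%:R <= B.
  have [mj Sa Xa] := AP j.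
  have up : `|L j F| <= (2 * n)%:R * (2 * C / (m j)%:R).
    pose G (x : 'rV[R]_(2 * n)) := \sum_k phi k (x 0 k).
    rewrite /L (@eq_signed_mean _ _ _ _ _ F G) => [|i].
      rewrite signed_mean_sum; apply: le_trans (ler_norm_sum _ _ _) _.
      rewrite mulr_natl -[X in _ *+ X]card_ord -sumr_const.
      apply: ler_sum => k _; apply: (Sternfeld_mean_coord Sa (m0 j)) => i.
      exact: CP.
    exact: phiF (Xa i).
  have {up} := le_trans (LF j) up.
  rewrite !mulrA ler_pdivlMr ?ltr0n // exprVn => up.
  have p0 : 0 < 3 ^+ j :> R by apply: exprn_gt0.
  have mj' : j.+1%:R * 3 ^+ j <= (m j)%:R :> R by rewrite -natrX -natrM ler_nat.
  have : j.+1%:R / 2 <= (3 ^+ j)^-1 / 2 * (m j)%:R :> R.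
    rewrite [leRHS]mulrAC ler_pM2r; last lra.
    by rewrite mulrC ler_pdivlMr.
  by move: up; rewrite natrM /B; lra.
have := key (Num.bound B); have B0 : 0 <= B by apply: le_trans (key 0%N).
have := archi_boundP B0; rewrite -natr1; lra.
Qed.
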